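(* Let $n$ and $r$ be positive integers with $n \ge 4$. Then $$\operatorname{mr}^-\left(P_n^r\right) = \begin{cases} n-r & \text{if } 1 \le r \le n-3 \text{ and } n-r \text{ is even},\\ n-r+1 & \text{if } 1 \le r \le n-3 \text{ and } n-r \text{ is odd},\\ 2 & \text{if } r \ge n-2.\end{cases}$$
   Context: All graphs are simple (finite, loopless, undirected). For a graph $G$ on vertex set $\{1,\dots,n\}$, let $\mathcal{S}^-(G)$ be the set of real $n\times n$ skew-symmetric matrices $A=[a_{ij}]$ (i.e. $A^T=-A$) such that for $i\neq j$, $a_{ij}\neq 0$ if and only if $ij$ is an edge of $G$. The minimum skew rank of $G$ is $\operatorname{mr}^-(G)=\min\{\operatorname{rank}(A): A\in\mathcal{S}^-(G)\}$. $P_n$ denotes the path with vertex set $\{1,\dots,n\}$ where $ij$ is an edge iff $|i-j|=1$. For a positive integer $r$, the power $G^r$ is the graph on the same vertex set in which distinct vertices $i,j$ are adjacent iff there is a walk in $G$ from $i$ to $j$ of length at most $r$; thus in $P_n^r$, distinct $i,j$ are adjacent iff $|i-j|\le r$. *)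

(* Defs.v *)
From mathcomp Require Import all_boot all_order all_algebra.
From mathcomp Require Import boolp reals.

Set Implicit Arguments.
Unset Strict Implicit.
Unset Printing Implicit Defensive.

Import Order.TTheory GRing.Theory Num.Theory.
Local Open Scope ring_scope.

(* The vertex set {1, ..., n} is encoded as 'I_n = {0, ..., n-1}. *)
Record sgraph (n : nat) := SGraph {
  adj :> rel 'I_n;
  adj_sym : symmetric adj;
  adj_irr : irreflexive adj
}.

Section Path.
Variable n : nat.

(* The absolute value is taken in int, so the difference is not truncated. *)
Definition path_adj : rel 'I_n := fun i j => `|i%:Z - j%:Z| == 1.

Lemma path_adj_sym : symmetric path_adj.
Proof. by move=> i j; rewrite /path_adj distrC. Qed.

Lemma path_adj_irr : irreflexive path_adj.
Proof. by move=> i; rewrite /path_adj subrr normr0. Qed.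

Definition path_graph : sgraph n := SGraph path_adj_sym path_adj_irr.

End Path.

Section Power.
Variables (n : nat) (G : sgraph n) (r : nat).

(* The tuple p lists the vertices of the walk after its first vertex i, so its
   length k is the number of edges of the walk. *)
Definition walk_le : rel 'I_n := fun i j =>
  [exists k : 'I_r.+1, [exists p : k.-tuple 'I_n,
     path G i p && (last i p == j)]].

Lemma walk_le_sym : symmetric walk_le.
Proof.
suff H i j : walk_le i j -> walk_le j i by move=> i j; apply/idP/idP; apply: H.
case/existsP=> k /existsP[p /andP[Gp /eqP <-]].
have sz : size (rev (belast i p)) == k by rewrite size_rev size_belast size_tuple.
apply/existsP; exists k; apply/existsP; exists (Tuple sz); apply/andP; split => /=.
  by rewrite rev_path (eq_path (e' := G)) // => x y /=; rewrite adj_sym.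
by case: (tval p) => //= x s; rewrite rev_cons last_rcons.
Qed.

Definition power_adj : rel 'I_n := fun i j => (i != j) && walk_le i j.

Lemma power_adj_sym : symmetric power_adj.
Proof. by move=> i j; rewrite /power_adj eq_sym walk_le_sym. Qed.

Lemma power_adj_irr : irreflexive power_adj.
Proof. by move=> i; rewrite /power_adj eqxx. Qed.

Definition graph_power : sgraph n := SGraph power_adj_sym power_adj_irr.

End Power.

Section MinimumSkewRank.
Variables (R : realType) (n : nat) (G : sgraph n).

Definition skew_mx_of_graph (A : 'M[R]_n) : Prop :=
  A^T = - A /\ forall i j : 'I_n, i != j -> (A i j <> 0 <-> adj G i j).

Definition skew_rank_attained (k : nat) : bool :=
  `[< exists A : 'M[R]_n, skew_mx_of_graph A /\ \rank A = k >].

Lemma skew_rank_attained_ex : exists k, skew_rank_attained k.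
Proof.
pose A : 'M[R]_n :=
  \matrix_(i, j) (if G i j then if (i < j)%N then 1 else -1 else 0).
exists (\rank A); apply/asboolP; exists A; split=> //; split.
  apply/matrixP=> i j; rewrite !mxE adj_sym; case: ifP => [Gij|_]; last by rewrite oppr0.
  case: ltngtP => [||/val_inj ij]; rewrite ?opprK //.
  by rewrite ij adj_irr in Gij.
move=> i j _; rewrite mxE; case: (G i j); split=> // _.
by case: ifP => _; apply/eqP; rewrite ?oppr_eq0 oner_eq0.
Qed.

Definition min_skew_rank : nat := ex_minn skew_rank_attained_ex.

End MinimumSkewRank.

(* Main.v *)
(* Lower bound: rows 0..n-r-1 against columns r..n-1 form an invertible
   triangular matrix, and a skew-symmetric matrix has even rank.
   Upper bound: cover the edges by the m intervals [2k, 2k+r+1], with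
   n <= r + 2m. On each interval put a skew-symmetric matrix of rank 2 that is
   positive above the diagonal except for the pair of endpoints, where it
   vanishes. As no cancellation can occur in the sum of these matrices, its
   graph is exactly the r-th power of the path, and its rank is at most 2m. *)
Require Import Defs.
From mathcomp Require Import all_boot all_order all_algebra.
From mathcomp Require Import boolp reals.
From mathcomp Require Import zify lra.

Import Order.TTheory GRing.Theory Num.Theory.
Local Open Scope ring_scope.

Lemma path_walk_le n (i : 'I_n) (p : seq 'I_n) :
  path (path_graph n) i p ->
  (last i p <= i + size p)%N && (i <= last i p + size p)%N.
Proof.
elim: p i => [|x p IHp] i /=; first by rewrite !addn0 leqnn.
case/andP=> ix /IHp /andP[h1 h2]; move: ix; rewrite /path_adj => ix.
apply/andP; split; lia.
Qed.

Lemma exists_path_walk n d (i j : 'I_n) : j = (i + d)%N :> nat ->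
  exists p : d.-tuple 'I_n, path (path_graph n) i p /\ last i p = j.
Proof.
elim: d i => [|d IHd] i ij.
  by exists [tuple]; split=> //; apply: val_inj; rewrite /= ij addn0.
have lt_in : (i.+1 < n)%N by have := ltn_ord j; lia.
have [|p [ip pj]] := IHd (Ordinal lt_in); first by rewrite /= ij addnS.
exists [tuple of Ordinal lt_in :: p]; split=> //=.
by rewrite ip andbT /path_adj /=; lia.
Qed.

(** Each step of a walk changes the index by one, and the monotone walk attains the distance. Two
    additive bounds avoid truncated subtraction. *)
Lemma path_powerE n r (i j : 'I_n) :
  graph_power (path_graph n) r i j =
    [&& i != j, j <= i + r & i <= j + r]%N.
Proof.
wlog le_ij : i j / (i <= j)%N.
  move=> IH; case/orP: (leq_total i j) => [/IH//|/IH h].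
  by rewrite adj_sym h eq_sym [X in _ && X]andbC.
rewrite /= /power_adj; congr (_ && _); apply/idP/idP.
  case/existsP=> k /existsP[p /andP[/path_walk_le + /eqP lp]].
  by rewrite lp size_tuple; have := ltn_ord k; lia.
move=> /andP[h _].
have lt_kr : (j - i < r.+1)%N by lia.
have [|p [ip pj]] := @exists_path_walk n (j - i) i j; first by lia.
apply/existsP; exists (Ordinal lt_kr); apply/existsP; exists p.
by rewrite ip pj eqxx.
Qed.

(** Compressing [A] to its row space gives [A = B^T S B] with [S] skew-symmetric and invertible of
    size [\rank A]; an odd size would force [\det S = - \det S], hence [\det S = 0]. *)
Lemma skew_rank_even {F : numFieldType} {n} {A : 'M[F]_n} :
  A^T = - A -> ~~ odd (\rank A).
Proof.
move=> skewA; set B := row_base A.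
have /row_freeP[C BC] : row_free B by apply: row_base_free.
have /submxP[X AX] : (A <= B)%MS by rewrite eq_row_base.
have CB : C^T *m B^T = 1%:M by rewrite -trmx_mul BC trmx1.
(* The product [C *m B] acts as the identity on the row space of [A], because [B *m C = 1]. *)
have AE : A = A *m C *m B.
    by rewrite [X in X *m C]AX -(mulmxA X) BC mulmx1 -AX.
have AE' : A = B^T *m C^T *m A.
  by apply: oppr_inj; rewrite -mulmxN -skewA [in LHS]AE !trmx_mul mulmxA.
pose S := C^T *m A *m C.
have AS : A = B^T *m S *m B.
    have -> : B^T *m S *m B = B^T *m C^T *m (A *m C *m B) by rewrite /S !mulmxA.
    by rewrite -AE -AE'.
have rS : S \in unitmx.
  rewrite -row_free_unit /row_free eqn_leq rank_leq_row /=.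
  by rewrite {1}AS (leq_trans (mxrankM_maxl _ _)) ?mxrankM_maxr.
have skewS : S^T = - S by rewrite /S !trmx_mul trmxK skewA mulNmx mulmxN mulmxA.
apply/negP=> odd_r; move: rS; rewrite unitmxE unitfE.
have: \det S = - \det S.
  by rewrite -{1}det_tr skewS -scaleN1r detZ -signr_odd odd_r expr1 mulN1r.
by move/eqP; rewrite -addr_eq0 -mulr2n mulrn_eq0 /= => ->.
Qed.

Lemma leq_rank_mxsub {F : fieldType} {m n m' n'} (f : 'I_m' -> 'I_m)
    (g : 'I_n' -> 'I_n) (A : 'M[F]_(m, n)) :
  (\rank (mxsub f g A) <= \rank A)%N.
Proof.
have -> : mxsub f g A = rowsub f 1%:M *m A *m colsub g 1%:M.
  by rewrite -rowsubE -mxsub_mul mulmx1.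
exact: leq_trans (mxrankM_maxl _ _) (mxrankM_maxr _ _).
Qed.

Section LowerBound.
Context {R : realType} {n r : nat} {A : 'M[R]_n}.
Hypothesis GA : skew_mx_of_graph (graph_power (path_graph n) r) A.

(* Rows 0, ..., n-r-1 against columns r, ..., n-1 form a triangular matrix
   whose diagonal consists of the entries at distance exactly r. *)
Lemma path_power_rank_ge : (0 < r)%N -> (n - r <= \rank A)%N.
Proof.
move=> r_gt0; case: GA => _ adjA.
have lt_row (i : 'I_(n - r)) : (i < n)%N by have := ltn_ord i; lia.
have lt_col (i : 'I_(n - r)) : (r + i < n)%N by have := ltn_ord i; lia.
pose f i := Ordinal (lt_row i); pose g i := Ordinal (lt_col i).
(* For [i <= j] the indices [i] and [r + j] are at distance [r + (j - i)], so they are adjacent only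
   on the diagonal. *)
have fg (i j : 'I_(n - r)) : (i <= j)%N -> (A (f i) (g j) != 0) = (i == j).
  move=> le_ij; have neq : f i != g j by rewrite -val_eqE /=; lia.
  have [h1 h2] := adjA _ _ neq.
  move: h1 h2; rewrite path_powerE neq /= => h1 h2.
  apply/idP/eqP=> [/eqP/h1 h|ij]; first by apply: val_inj => /=; lia.
  by apply/eqP/h2; rewrite ij; lia.
apply: leq_trans (leq_rank_mxsub f g A).
have /mxrank_unit-> // : mxsub f g A \in unitmx.
rewrite unitmxE unitfE det_trig.
  by apply/prodf_neq0=> i _; rewrite mxE fg.
apply/is_trig_mxP=> i j lt_ij; rewrite mxE; apply/eqP.
by apply: negbNE; rewrite fg ?(ltnW lt_ij)// -val_eqE /= ltn_eqF.
Qed.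

Lemma path_power_rank_ge2 : (0 < r)%N -> (1 < n)%N -> (2 <= \rank A)%N.
Proof.
move=> r_gt0 n_gt1; have := skew_rank_even (proj1 GA).
suff: \rank A != 0%N by case: (\rank A) => [|[]].
rewrite mxrank_eq0; apply/eqP=> A0; case: GA => _ adjA.
have n_gt0 : (0 < n)%N by lia.
have [] := adjA (Ordinal n_gt0) (Ordinal n_gt1) isT.
by rewrite path_powerE A0 mxE => _; apply=> //=; rewrite add0n r_gt0.
Qed.

End LowerBound.

Section UpperBound.
Variables (R : realType) (r : nat).

(* The vectors (block_x a t, block_y a t), a <= t <= a + r + 1, have
   increasing angles from 0 to pi, so the determinant of two of them, in
   increasing order, is positive except for the two opposite extreme ones. *)
Definition block_x (a t : nat) : R :=
  if t == a then 1 else if (a < t <= a + r)%N then - t%:R else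
  if t == (a + r.+1)%N then -1 else 0.

Definition block_y (a t : nat) : R := if (a < t <= a + r)%N then 1 else 0.

Definition block_det (a s t : nat) : R :=
  block_x a s * block_y a t - block_y a s * block_x a t.

Lemma block_det_ge0 a s t : (s < t)%N -> 0 <= block_det a s t.
Proof.
move=> lt_st; have : s%:R < t%:R :> R by rewrite ltr_nat.
rewrite /block_det /block_x /block_y; do !case: ifP; try lia; lra.
Qed.

(** Within the interval the determinant is [t - s] for two interior points and 1 for an endpoint
    with an interior point; [t <= s + r] discards just the pair of endpoints. *)
Lemma block_det_neq0 a s t : (s < t)%N ->
  (block_det a s t != 0) = [&& a <= s, t <= a + r.+1 & t <= s + r]%N.
Proof.
move=> lt_st; have lt_stR : s%:R < t%:R :> R by rewrite ltr_nat.
apply/idP/idP.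
  apply: contraNT => nP; apply/eqP; move: nP.
  rewrite /block_det /block_x /block_y; do !case: ifP; try lia; move=> *; lra.
move=> P; apply/eqP; move: P.
rewrite /block_det /block_x /block_y; do !case: ifP; try lia; move=> *; lra.
Qed.

Definition block_mx n (a : nat) : 'M[R]_n := \matrix_(i, j) block_det a i j.

Lemma rank_block_mx n a : (\rank (block_mx n a) <= 2)%N.
Proof.
pose x := \col_(i < n) block_x a i; pose y := \col_(i < n) block_y a i.
have -> : block_mx n a = x *m y^T - y *m x^T.
  by apply/matrixP=> i j; rewrite !mxE !big_ord1 !mxE.
apply: leq_trans (mxrank_add _ _) _; rewrite mxrank_opp.
by apply: (@leq_add _ _ 1 1);
  apply: leq_trans (mxrankM_maxl _ _) (rank_leq_col _).
Qed.

Definition band_mx n m : 'M[R]_n := \sum_(k < m) block_mx n k.*2.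

Lemma rank_band_mx n m : (\rank (band_mx n m) <= m.*2)%N.
Proof.
rewrite /band_mx; elim: m => [|m IHm]; first by rewrite big_ord0 mxrank0.
rewrite big_ord_recr /= (leq_trans (mxrank_add _ _))// doubleS -addn2.
by rewrite leq_add ?rank_block_mx.
Qed.

Lemma band_mx_skew n m : (band_mx n m)^T = - band_mx n m.
Proof.
apply/matrixP=> i j; rewrite !mxE !summxE -sumrN; apply: eq_bigr => k _.
by rewrite !mxE /block_det opprB mulrC [_ * block_x _ i]mulrC.
Qed.

Lemma band_mx_neq0 n m (i j : 'I_n) : (0 < m)%N -> (n <= r + m.*2)%N ->
  (i < j)%N -> (band_mx n m i j != 0) = (j <= i + r)%N.
Proof.
(* A sum of nonnegative entries vanishes only if every term does. *)
move=> m_gt0 le_n lt_ij; rewrite summxE psumr_eq0; last first.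
  by move=> k _; rewrite mxE block_det_ge0.
rewrite -has_predC; apply/hasP/idP=> [[k _]|le_j].
  by rewrite /= mxE block_det_neq0// => /and3P[].
(* The last interval starting at or before [i] contains [j]: it starts at [i - 1] or later, or else
   it is the final one, which reaches [r + 2m - 1 >= n - 1]. *)
have lt_m : (minn i./2 m.-1 < m)%N by lia.
exists (Ordinal lt_m); first exact: mem_index_enum.
rewrite /= mxE block_det_neq0//=.
by have := ltn_ord j; lia.
Qed.

Lemma band_mx_graph n m : (0 < m)%N -> (n <= r + m.*2)%N ->
  skew_mx_of_graph (graph_power (path_graph n) r) (band_mx n m).
Proof.
move=> m_gt0 le_n; split=> [|i j neq_ij]; first exact: band_mx_skew.
have -> : (band_mx n m i j <> 0) <-> (band_mx n m i j != 0) by split=> /eqP.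
wlog lt_ij : i j neq_ij / (i < j)%N.
  move=> IH; case: (ltngtP i j) => [/(IH _ _ neq_ij)//|/IH|/val_inj eq_ij].
    rewrite adj_sym eq_sym => /(_ neq_ij); have := band_mx_skew n m.
    by move=> /matrixP/(_ j i); rewrite !mxE => ->; rewrite oppr_eq0.
  by rewrite eq_ij eqxx in neq_ij.
rewrite band_mx_neq0// path_powerE neq_ij /=.
have -> : (i <= j + r)%N by lia.
by rewrite andbT.
Qed.

End UpperBound.

Theorem mainTheorem1 (R : realType) (n r : nat) (hn : (4 <= n)%N) (hr : (1 <= r)%N) :
  [/\ (r <= n - 3)%N -> ~~ odd (n - r) ->
        min_skew_rank R (graph_power (path_graph n) r) = (n - r)%N,
      (r <= n - 3)%N -> odd (n - r) ->
        min_skew_rank R (graph_power (path_graph n) r) = (n - r + 1)%N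
    & (n - 2 <= r)%N ->
        min_skew_rank R (graph_power (path_graph n) r) = 2%N].
Proof.
rewrite /min_skew_rank.
case: ex_minnP => k /asboolP[A [GA <-]] min_k.
have ub m : (0 < m)%N -> (n <= r + m.*2)%N -> (\rank A <= m.*2)%N.
  move=> m_gt0 le_n; apply: leq_trans (rank_band_mx R r n m).
  apply/min_k/asboolP; exists (band_mx R r n m); split=> //.
  exact: band_mx_graph.
have even_rank := skew_rank_even (proj1 GA).
have ge_rank := path_power_rank_ge GA hr.
have ge2_rank := path_power_rank_ge2 GA hr (leq_trans (isT : 1 < 4)%N hn).
move: (\rank A) ub even_rank ge_rank ge2_rank => k' ub.
(* The least [m] with [n <= r + 2m]; then [2m] is [n - r] rounded up to an even number, as is the
   lower bound by parity of the rank. *)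
have ub_rank := ub (uphalf (n - r)).
(* One interval suffices when [r >= n - 2], including [r >= n], where [uphalf (n - r)] is 0. *)
have ub1 := ub 1%N isT.
by move=> *; split=> *; lia.
Qed.
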